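(* Let $n\ge 2$ be an integer. For $u\in[-\pi,\pi]$ let $$g_n(u)=n^2\sin^2 u-\sin^2(nu),$$ and let $v(n,u)$ be the unique non-negative root $v$ of the equation $$\sinh^2(nv)-n^2\sinh^2 v=g_n(u),\qquad v\ge 0$$ (this equation has exactly one root $v\ge 0$). Let $\mu(n,u)=u+i\,v(n,u)$ and $$f_n^{(1)}(u)=\frac{\sin\frac{(n+1)\mu(n,u)}{2}}{\sin\frac{(n-1)\mu(n,u)}{2}},\qquad b_n^{(1)}(u)=-\frac{\sin[n\mu(n,u)]}{\sin\mu(n,u)},$$ $$f_n^{(2)}(u)=\frac{\cos\frac{(n+1)\mu(n,u)}{2}}{\cos\frac{(n-1)\mu(n,u)}{2}},\qquad b_n^{(2)}(u)=\frac{\sin[n\mu(n,u)]}{\sin\mu(n,u)}.$$ Let $\rho,\lambda\in\mathbb{C}$. Then $\lambda$ is a borderline type-1 eigenvalue of $K_n(\rho)$ if and only if there is $u\in[-\pi,\pi]$ with $\rho=f_n^{(1)}(u)$ and $\lambda=b_n^{(1)}(u)$. Similarly, $\lambda$ is a borderline type-2 eigenvalue of $K_n(\rho)$ if and only if there is $u\in[-\pi,\pi]$ with $\rho=f_n^{(2)}(u)$ and $\lambda=b_n^{(2)}(u)$.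
   Context: For an integer $n\ge 2$ and $\rho\in\mathbb{C}$, $K_n(\rho)=[\rho^{|j-k|}]_{j,k=1}^n$ (with ones on the diagonal, also when $\rho=0$). An eigenvalue $\lambda\in\mathbb{C}$ of $K_n(\rho)$ is called borderline if $|\lambda|=n$. A vector $y\in\mathbb{C}^n$ is symmetric if $y_{n+1-j}=y_j$ for all $j$, and skew-symmetric if $y_{n+1-j}=-y_j$ for all $j$. An eigenvalue of $K_n(\rho)$ is of type-1 if it has a nonzero skew-symmetric eigenvector, and of type-2 if it has a nonzero symmetric eigenvector. Quotients of the form $0/0$ (which can arise only at $u=0,\pm\pi$) are understood as removable singularities in the variable $\mu$, i.e. by their limiting values. *)

(* Defs.v *)
From mathcomp Require Import all_boot all_order all_algebra.
From mathcomp Require Import complex.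
From mathcomp Require Import all_classical all_reals all_analysis.

Set Implicit Arguments.
Unset Strict Implicit.
Unset Printing Implicit Defensive.

Import Order.TTheory GRing.Theory Num.Theory.
Import numFieldNormedType.Exports.

Local Open Scope classical_set_scope.
Local Open Scope complex_scope.
Local Open Scope ring_scope.

Section Functions.
Context {R : realType}.
Implicit Types (x : R) (z w : R[i]).

Definition sinh x : R := (expR x - expR (- x)) / 2.

Definition cexp z : R[i] :=
  (expR (complex.Re z) * cos (complex.Im z)) +i*
  (expR (complex.Re z) * sin (complex.Im z)).

Definition csin z : R[i] := (cexp ('i * z) - cexp (- ('i * z))) / (2 * 'i).
Definition ccos z : R[i] := (cexp ('i * z) + cexp (- ('i * z))) / 2.

(* The value at z of the quotient num / den, where 0 / 0 is replaced by the
   limit of num w / den w as w tends to z in the complex plane, w != z. The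
   type R[i]^o carries the topology of the norm of R[i]. *)
Definition removable_quot (num den : R[i] -> R[i]) z : R[i] :=
  if (num z == 0) && (den z == 0)
  then lim ((fun w : R[i]^o => num w / den w : R[i]^o) @ (z : R[i]^o)^')
  else num z / den z.

End Functions.

Section Matrix.
Context {R : realType} (n : nat).
Implicit Types (rho lam : R[i]) (y : 'cV[R[i]]_n).

(* 0 ^+ 0 = 1, so the diagonal entries are 1 for rho = 0 too. *)
Definition Kmx rho : 'M[R[i]]_n := \matrix_(j, k) rho ^+ `|j - k|%N.

(* Indices start at 0 here, and rev_ord j is n - 1 - j. *)
Definition symmetric_vec y := forall j, y (rev_ord j) 0 = y j 0.
Definition skew_symmetric_vec y := forall j, y (rev_ord j) 0 = - y j 0.

Definition eigenvector (A : 'M[R[i]]_n) lam y := y != 0 /\ A *m y = lam *: y.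

Definition type1_eigenvalue rho lam :=
  exists y, eigenvector (Kmx rho) lam y /\ skew_symmetric_vec y.
Definition type2_eigenvalue rho lam :=
  exists y, eigenvector (Kmx rho) lam y /\ symmetric_vec y.

Definition borderline lam := `|lam| = n%:R.

End Matrix.

Section Curves.
Context {R : realType} (n : nat).
Implicit Types (u v : R).

Definition g_ u : R := n%:R ^+ 2 * sin u ^+ 2 - sin (n%:R * u) ^+ 2.

Definition v_root u v :=
  0 <= v /\ sinh (n%:R * v) ^+ 2 - n%:R ^+ 2 * sinh v ^+ 2 = g_ u.

(* The default value 0 is used only if there is no root. *)
Definition v_ u : R := xget 0 [set v | v_root u v].

Definition mu_ u : R[i] := u +i* v_ u.

Definition f1 u : R[i] :=
  removable_quot (fun w => csin ((n%:R + 1) * w / 2))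
                 (fun w => csin ((n%:R - 1) * w / 2)) (mu_ u).
Definition b1 u : R[i] :=
  - removable_quot (fun w => csin (n%:R * w)) csin (mu_ u).
Definition f2 u : R[i] :=
  removable_quot (fun w => ccos ((n%:R + 1) * w / 2))
                 (fun w => ccos ((n%:R - 1) * w / 2)) (mu_ u).
Definition b2 u : R[i] :=
  removable_quot (fun w => csin (n%:R * w)) csin (mu_ u).

End Curves.

(* Main.v *)
Require Import Defs.
From mathcomp Require Import all_boot all_order all_algebra.
From mathcomp Require Import complex.
From mathcomp Require Import all_classical all_reals all_analysis.
From mathcomp Require Import ring lra zify.
Import Order.TTheory GRing.Theory Num.Theory.
Import numFieldNormedType.Exports.
Local Open Scope ring_scope.

(** Write eps = -1 for type-1 and eps = 1 for type-2, so that both types ask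
for an eigenvector y of K_n(rho) with y_(n+1-j) = eps y_j. Splitting row j of
K_n(rho) y into the geometric sums over k < j and over k > j turns the
eigenvalue equation into a three-term recurrence for y with the boundary
condition y_0 = rho y_1, the condition at the other end being its mirror image
([eigen_palindromic], [palindromic_eigen]). If z is a root of the
characteristic polynomial of the recurrence and z^2 <> 1, the solutions of
parity eps are the multiples of z^j + eps z^(n+1-j); the boundary condition
then gives rho and the recurrence coefficient gives lam as explicit functions
of z. If z = 1 or z = -1 the solutions are z^j (A + B j), and those of parity
eps are the multiples of z^j or those of z^j (n+1-2j). The relation
[curve_point] collects these three cases; it determines (rho, lam) from z, and
[parity_eigenvalue_curve] says that a number of modulus n is an eigenvalue of
parity eps exactly when such a z exists. As z and 1/z are the two roots, one
may take |z| <= 1.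

Put z = e^(i mu), mu = u + i v, with u in [-pi, pi] and v >= 0 ([cis_surj]).
Away from z^2 = 1 one has lam sin mu = eps sin (n mu), and
|sin (a + i b)|^2 = sin^2 a + sinh^2 b, so that |lam| = n is the equation that
defines v(n, u) ([borderline_curve]). That equation has one root because its
left side is sinh^2 v (q(v)^2 - n^2), where q(v) = sinh (n v) / sinh v is a sum
of hyperbolic cosines, hence increasing from the value n at v = 0, whereas
g_n(u) >= 0 because |sin (n u)| <= n |sin u| ([v_root_exists_unique]). This
last inequality is strict unless sin u = 0, so that v(n, u) = 0 forces z = 1 or
z = -1; therefore the denominators of the two curves vanish only at removable
singularities.

Finally the quotients defining the curves are, up to a power of z, of the form
(z^p - s) / (z^q - s). If z0 is a common zero, both parts are divisible by
z - z0 and the limiting value can be read off from the cofactors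
([removable_quot_cis]). These values satisfy [curve_point]
([boundary_ratio_curve]), and since z determines (rho, lam) there, the two
descriptions agree. *)

Set Implicit Arguments.
Unset Strict Implicit.
Unset Printing Implicit Defensive.

(** * Eigenvectors as solutions of a three-term recurrence *)

(** The rational identities below follow from given equations by explicit
cofactors; once the cofactors are supplied, a polynomial identity remains. *)
Lemma lincomb1 (R : comNzRingType) (c l r a b : R) :
  l = r -> a - b = c * (l - r) -> a = b.
Proof. by move=> ->; rewrite subrr mulr0; apply: subr0_eq. Qed.

Lemma lincomb2 (R : comNzRingType) (c1 c2 l1 r1 l2 r2 a b : R) :
  l1 = r1 -> l2 = r2 ->
  a - b = c1 * (l1 - r1) + c2 * (l2 - r2) -> a = b.
Proof. by move=> -> ->; rewrite !subrr !mulr0 addr0; apply: subr0_eq. Qed.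

Lemma lincomb3 (R : comNzRingType) (c1 c2 c3 l1 r1 l2 r2 l3 r3 a b : R) :
  l1 = r1 -> l2 = r2 -> l3 = r3 ->
  a - b = c1 * (l1 - r1) + c2 * (l2 - r2) + c3 * (l3 - r3) -> a = b.
Proof. by move=> -> -> ->; rewrite !subrr !mulr0 !addr0; apply: subr0_eq. Qed.

Arguments lincomb1 {R} c {l r a b}.
Arguments lincomb2 {R} c1 c2 {l1 r1 l2 r2 a b}.
Arguments lincomb3 {R} c1 c2 c3 {l1 r1 l2 r2 l3 r3 a b}.

Section Sequences.
Variable F : fieldType.
Implicit Types (rho lam eps : F) (X Y : nat -> F).

Definition lsum rho Y j := \sum_(k < j) rho ^+ (j - k) * Y k.

Lemma lsum0 rho Y : lsum rho Y 0 = 0.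
Proof. by rewrite /lsum big_ord0. Qed.

Lemma lsumS rho Y j : lsum rho Y j.+1 = rho * (lsum rho Y j + Y j).
Proof.
rewrite /lsum big_ord_recr /= subSnn expr1 mulrDr; congr (_ + _).
rewrite mulr_sumr; apply: eq_bigr => k _.
by rewrite subSn 1?ltnW // exprS mulrA.
Qed.

(** The reflection k -> n - 1 - k carries the terms right of the diagonal in
row j to the terms left of it in row n - 1 - j, so by parity one family of
partial sums is enough. *)
Lemma kms_row n rho eps Y j : (j < n)%N ->
  (forall k, (k < n)%N -> Y (n.-1 - k)%N = eps * Y k) ->
  \sum_(k < n) rho ^+ `|j - k|%N * Y k =
    lsum rho Y j + Y j + eps * lsum rho Y (n.-1 - j)%N.
Proof.
move=> ltjn symY.
rewrite -(big_mkord xpredT (fun k => rho ^+ `|j - k|%N * Y k)).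
rewrite (big_cat_nat _ (ltnW ltjn)) //= (big_ltn ltjn) distnn expr0 mul1r addrA.
congr (_ + _ + _).
  by rewrite big_mkord; apply: eq_bigr => k _; rewrite distnEl // ltnW.
have -> : (n.-1 - j = n - j.+1)%N by lia.
rewrite /lsum mulr_sumr -[j.+1]add0n big_addn.
rewrite -(big_mkord xpredT
  (fun i => eps * (rho ^+ (n - (0 + j.+1) - i) * Y i))).
rewrite [RHS]big_nat_rev add0n.
apply: eq_big_nat => k /andP[_ ltk].
rewrite mulrCA -symY; last by lia.
rewrite distnEr; last by lia.
by congr (rho ^+ _ * Y _); lia.
Qed.

(** The entries of the eigenvector are X_1, ..., X_n. The values X_0 and
X_(n+1) are added so that the first and the last row satisfy the same
recurrence as the others; by parity the boundary condition at X_(n+1) follows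
from that at X_0. The recurrence is kept free of division by lam and rho. *)
Record palindromic_solution n eps rho lam X : Prop := PalindromicSolution {
  pal_bound : X 0%N = rho * X 1%N;
  pal_sym : forall i, (i <= n.+1)%N -> X (n.+1 - i)%N = eps * X i;
  pal_rec : forall i, (i < n)%N -> lam * rho * (X i + X i.+2) =
    ((1 + rho ^+ 2) * lam - (1 - rho ^+ 2)) * X i.+1 }.

(** With L_j the sum over k < j in row j, induction on j gives
(1 - rho^2) (L_j + X_(j+1)) = lam (X_(j+1) - rho X_(j+2)). Adding the mirror
image of this identity and using the recurrence once more gives the eigenvalue
equation multiplied by 1 - rho^2. *)
Lemma palindromic_eigen n eps rho lam X : eps ^+ 2 = 1 -> rho ^+ 2 != 1 ->
  palindromic_solution n eps rho lam X ->
  forall j, (j < n)%N ->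
    \sum_(k < n) rho ^+ `|j - k|%N * X k.+1 = lam * X j.+1.
Proof.
move=> eps2 rho2 [X0 symX recX] j ltjn.
pose L := lsum rho (fun k => X k.+1).
have symY k : (k < n)%N -> X (n.-1 - k).+1 = eps * X k.+1.
  by move=> ltk; rewrite -symX; [congr X|]; lia.
rewrite (@kms_row n rho eps (fun k => X k.+1) j ltjn symY) -/L.
have key i : (i < n)%N ->
    (1 - rho ^+ 2) * (L i + X i.+1) = lam * (X i.+1 - rho * X i.+2).
  elim: i => [|i IH] lti; have rec := recX _ lti.
    by apply: (lincomb1 1 rec); rewrite /L lsum0 X0; ring.
  have {}IH := IH (ltnW lti).
  by apply: (lincomb2 rho 1 IH rec); rewrite {1}/L lsumS -/L; ring.
have keyj := key _ ltjn.
have keyr : (1 - rho ^+ 2) * (eps * L (n.-1 - j)%N + X j.+1) =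
    lam * (X j.+1 - rho * X j).
  have -> : X j.+1 = eps * X (n.-1 - j).+1.
    by rewrite symY // mulrA -expr2 eps2 mul1r.
  have -> : X j = eps * X (n.-1 - j).+2.
    have -> : ((n.-1 - j).+2 = n.+1 - j)%N by lia.
    by rewrite symX ?mulrA -?expr2 ?eps2 ?mul1r //; lia.
  have lt' : (n.-1 - j < n)%N by lia.
  by apply: (lincomb1 eps (key _ lt')); ring.
have rho2' : 1 - rho ^+ 2 != 0 by rewrite subr_eq0 eq_sym.
apply: (mulfI rho2').
have keyjr : (1 - rho ^+ 2) * (L j + eps * L (n.-1 - j)%N + 2 * X j.+1) =
   lam * (2 * X j.+1 - rho * (X j + X j.+2)).
  by apply: (lincomb2 1 1 keyj keyr); ring.
by apply: (lincomb2 1 (-1) keyjr (recX _ ltjn)); ring.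
Qed.

(** Row j minus rho times row j + 1 leaves (1 - rho^2) (L_j + Y_j), because the
sums right of the diagonal cancel; comparing the resulting identities for
consecutive j eliminates L. *)
Lemma eigen_palindromic n eps rho lam Y : (0 < n)%N -> eps ^+ 2 = 1 ->
  (forall k, (k < n)%N -> Y (n.-1 - k)%N = eps * Y k) ->
  (forall j, (j < n)%N -> \sum_(k < n) rho ^+ `|j - k|%N * Y k = lam * Y j) ->
  exists2 X, palindromic_solution n eps rho lam X &
    forall k, (k < n)%N -> X k.+1 = Y k.
Proof.
move=> n0 eps2 symY eigY.
pose X i := if i == 0%N then rho * Y 0%N else
            if i == n.+1 then rho * Y n.-1 else Y i.-1.
have XY k : (k < n)%N -> X k.+1 = Y k.
  by rewrite /X /= eqSS => ltk; rewrite ltn_eqF.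
have Xlast : X n.+1 = rho * Y n.-1 by rewrite /X eqxx.
exists X => //.
pose L := lsum rho Y.
have key j : (j < n)%N ->
    lam * (X j.+1 - rho * X j.+2) = (1 - rho ^+ 2) * (L j + X j.+1).
  move=> ltj; have eigj := eigY _ ltj.
  rewrite (kms_row _ ltj symY) -/L in eigj.
  have [ltSj|] := ltnP j.+1 n; last first.
    move=> leSj; have ej : j = n.-1 by lia.
    rewrite ej subnn {2}/L lsum0 in eigj.
    have XSj : X j.+1 = Y n.-1 by rewrite (XY _ ltj) ej.
    have XSSj : X j.+2 = rho * Y n.-1 by rewrite -Xlast; congr X; lia.
    rewrite XSj XSSj [in L j]ej.
    by apply: (lincomb1 (-(1 - rho ^+ 2)) eigj); ring.
  have eigSj := eigY _ ltSj.
  rewrite (kms_row _ ltSj symY) -/L in eigSj.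
  have e : (n.-1 - j = (n.-1 - j.+1).+1)%N by lia.
  rewrite e in eigj; rewrite !XY //.
  apply: (lincomb2 (- 1) rho eigj eigSj).
  have Ysym : Y (n.-1 - j.+1)%N = eps * Y j.+1 by rewrite symY.
  rewrite /L !lsumS -/L Ysym.
  have e2 : eps * (rho * (eps * Y j.+1)) = rho * Y j.+1.
    by rewrite mulrCA [eps * (eps * _)]mulrA -expr2 eps2 mul1r.
  by rewrite !mulrDr e2; ring.
split.
- by rewrite XY.
- move=> [|i] lei.
    by rewrite subn0 Xlast mulrCA -symY ?subn0.
  rewrite subSS; have [->|ni] := eqVneq i n.
    rewrite Xlast subnn /X /= mulrCA; congr (_ * _).
    by rewrite -symY ?subnn //; lia.
  have lti : (i < n)%N by lia.
  rewrite (XY _ lti) -symY //.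
  have -> : (n - i = (n.-1 - i).+1)%N by lia.
  by rewrite XY //; lia.
- move=> [|i] lti; have h := key _ lti.
    have -> : X 0%N = rho * X 1%N by rewrite XY.
    rewrite /L lsum0 in h.
    by apply: (lincomb1 (-1) h); ring.
  have h' := key _ (ltnW lti).
  apply: (lincomb2 (-1) rho h h').
  by rewrite /L lsumS -/L -(XY _ (ltnW lti)); ring.
Qed.
End Sequences.

(** * Solving the recurrence *)

Section CurvePoint.
Variable F : numFieldType.
Implicit Types (rho lam eps z : F) (X Y : nat -> F).

(** The pairs (rho, lam) that admit a solution of parity eps built from the
characteristic root z. In the generic case the solution is z^i + eps z^(n+1-i),
and both equations are cleared of denominators. If z^2 = 1, parity selects
either the solution z^i, for which the matrix is (z^(j-k)) and has rank one, or
the solution z^i (n+1-2i), for which rho and lam are the limits of the generic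
values. *)
Variant curve_point n eps rho lam z : Prop :=
| CurveGeneric of z ^+ 2 != 1 & 1 + eps * z ^+ n.-1 != 0
    & rho * (z * (1 + eps * z ^+ n.-1)) = 1 + eps * z ^+ n.+1
    & lam * (z ^+ n.-1 * (z ^+ 2 - 1)) = eps * (z ^+ (2 * n) - 1)
| CurveRankOne of z ^+ 2 = 1 & eps * z ^+ n.-1 = 1 & rho = z & lam = n%:R
| CurveDouble of z ^+ 2 = 1 & eps * z ^+ n.-1 = - 1
    & rho = z * (n.+1%:R / n.-1%:R) & lam = - n%:R.

Lemma curve_point_inj n eps z rho lam rho' lam' : z != 0 ->
  curve_point n eps rho lam z -> curve_point n eps rho' lam' z ->
  rho = rho' /\ lam = lam'.
Proof.
move=> z0; have neq1N1 : 1 <> - 1 :> F.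
  move=> /eqP; rewrite eq_sym -subr_eq0 -opprD oppr_eq0 -(natrD _ 1 1).
  by rewrite pnatr_eq0.
case=> [z1 D0 r l|z1 e -> ->|z1 e -> ->]
  [z1' D0' r' l'|z1' e' -> ->|z1' e' -> ->] //;
  try (by move: z1; rewrite z1' eqxx); try (by move: z1'; rewrite z1 eqxx).
- split.
    by apply: (mulIf (mulf_neq0 z0 D0)); rewrite r r'.
  have l0 : z ^+ n.-1 * (z ^+ 2 - 1) != 0.
    by rewrite mulf_neq0 ?expf_neq0 // subr_eq0.
  by apply: (mulIf l0); rewrite l l'.
- by case: neq1N1; apply: etrans (esym e) e'.
- by case: neq1N1; apply: etrans (esym e') e.
Qed.

Lemma sqr1_exprM z k : z ^+ 2 = 1 -> z ^+ k * z ^+ k = 1.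
Proof. by move=> z2; rewrite -expr2 exprAC z2 expr1n. Qed.

(** In the generic case rho^2 = 1 would make
1 - rho z (1 + eps z^(n-1)) + eps z^(n+1) factor as
(1 - rho z) (1 - rho eps z^n), whence z^(2n) = 1 and lam = 0; so
[palindromic_eigen] applies. *)
Lemma curve_point_eigen n eps rho lam z : (2 <= n)%N -> eps ^+ 2 = 1 ->
  z != 0 -> lam != 0 -> curve_point n eps rho lam z ->
  exists Y, [/\ exists2 k, (k < n)%N & Y k != 0,
    forall k, (k < n)%N -> Y (n.-1 - k)%N = eps * Y k &
    forall j, (j < n)%N -> \sum_(k < n) rho ^+ `|j - k|%N * Y k = lam * Y j].
Proof.
move=> n2 eps2 z0 lam0.
have pal X : (exists2 k, (k < n)%N & X k.+1 != 0) -> rho ^+ 2 != 1 ->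
    palindromic_solution n eps rho lam X -> exists Y,
   [/\ exists2 k, (k < n)%N & Y k != 0,
    forall k, (k < n)%N -> Y (n.-1 - k)%N = eps * Y k &
    forall j, (j < n)%N -> \sum_(k < n) rho ^+ `|j - k|%N * Y k = lam * Y j].
  move=> X0 rho2 palX; exists (fun k => X k.+1); split=> //.
    move=> k ltk; have [_ symX _] := palX.
    by rewrite -symX; [congr X|]; lia.
  exact: palindromic_eigen palX.
case: n n2 pal => [//|m] m1 /= pal.
case=> /= [z1 D0|z1 e|z1 e].
- rewrite mulnS mul2n -addnn !exprS !exprD [z ^+ 0]expr0 mulr1.
  set a := z ^+ m; move=> r l.
  have rho_neq : rho ^+ 2 != 1.
    apply/negP => /eqP rho2.
    have : (rho - 1) * (rho + 1) = 0.
      by apply: (lincomb1 1 rho2); ring.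
    (* That is z^(2n) <> 1, because lam <> 0. *)
    have aazz : a * a * z * z <> 1.
      move=> h; move/eqP: lam0; apply.
      have a0 : a * (z * z - 1) != 0.
        by rewrite mulf_neq0 ?expf_neq0 // subr_eq0 -expr2.
      by apply: (mulIf a0); apply: (lincomb2 1 eps l h); ring.
    have aazz' : (eps * (a * z)) ^+ 2 <> 1.
      move=> h; apply: aazz.
      by apply: (lincomb2 1 (- (a * z) ^+ 2) h eps2); ring.
    move/eqP; rewrite mulf_eq0 subr_eq0 addr_eq0 => /orP[] /eqP rhoE;
      rewrite rhoE in r; apply: aazz'.
    + have zN1 : 1 - z != 0.
        by apply: contra z1 => /eqP/subr0_eq <-; rewrite expr1n.
      suff -> : eps * (a * z) = 1 by rewrite expr1n.
      by apply: (mulfI zN1); apply: (lincomb1 1 r); ring.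
    + have zN1 : 1 + z != 0.
        apply: contra z1; rewrite addrC addr_eq0 => /eqP ->.
        by rewrite sqrrN expr1n.
      suff -> : eps * (a * z) = -1 by rewrite sqrrN expr1n.
      by apply: (mulfI zN1); apply: (lincomb1 (-1) r); ring.
  apply: (pal (fun i => z ^+ i + eps * z ^+ (m.+2 - i)%N) _ rho_neq).
    have [X1|X1] := eqVneq (z + eps * (z * a)) 0; last first.
      by exists 0%N => //; rewrite subn1 /= expr1 exprS.
    move/eqP: X1; rewrite mulrCA -{1}[z]mulr1 -mulrDr mulf_eq0.
    by rewrite (negPf z0) (negPf D0).
  split.
  + rewrite subn0 subn1 /= !exprS expr0 -/a.
    by apply: (lincomb1 (-1) r); ring.
  + move=> i lei; rewrite subKn // mulrDr mulrA -expr2 eps2 mul1r addrC; ring.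
  + move=> i lti.
    have -> : (m.+2 - i = (m - i).+2)%N by lia.
    have -> : (m.+2 - i.+2 = m - i)%N by lia.
    have -> : (m.+2 - i.+1 = (m - i).+1)%N by lia.
    rewrite !exprS.
    (* z is a root of the characteristic polynomial: with the value of rho
       inserted and denominators cleared, this is eps (z^2 - 1) times the
       equation for lam. *)
    have main : lam * rho * (z ^+ 2 + 1) =
        ((1 + rho ^+ 2) * lam - (1 - rho ^+ 2)) * z.
      have D0' : (1 + eps * a) ^+ 2 * z != 0.
        by rewrite mulf_neq0 // expf_neq0.
      apply/(mulfI D0')/eqP; move: eps2 => /eqP.
      rewrite sqrf_eq1 => /orP[] /eqP epsE;
        rewrite epsE in r l *; apply/eqP.
      - by apply: (lincomb2 (lam * (1 + a) * (z ^+ 2 + 1)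
          - (lam + 1) * (rho * z * (1 + a) + (1 + z ^+ 2 * a)))
          (z ^+ 2 - 1) r l); ring.
      - by apply: (lincomb2 (lam * (1 - a) * (z ^+ 2 + 1)
          - (lam + 1) * (rho * z * (1 - a) + (1 - z ^+ 2 * a)))
          (1 - z ^+ 2) r l); ring.
    apply: (lincomb1 (z ^+ i + eps * z ^+ (m - i)) main); ring.
- move=> -> ->.
  have zm : z ^+ m = eps by rewrite -[LHS]mul1r -eps2 expr2 -mulrA e mulr1.
  exists (fun k => z ^+ k); split.
  + by exists 0%N; rewrite ?expf_neq0.
  + move=> k ltk; rewrite -zm -(subnK (ltnSE ltk)) exprD addnK -mulrA.
    by rewrite sqr1_exprM // mulr1.
  + move=> j ltj; rewrite (eq_bigr (fun=> z ^+ j)).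
      by rewrite sumr_const card_ord mulr_natl.
    move=> k _; have [lejk|/ltnW lekj] := leqP j k.
      rewrite distnEr // -{2}(subnK lejk) exprD mulrA sqr1_exprM // mul1r //.
    by rewrite distnEl // -exprD subnK.
- move=> rhoE lamE.
  have m0 : m%:R != 0 :> F by rewrite pnatr_eq0 -lt0n.
  have zm : z ^+ m = - eps by rewrite -[LHS]mul1r -eps2 expr2 -mulrA e mulrN1.
  have rho2 : rho ^+ 2 = (m.+2%:R / m%:R) ^+ 2 by rewrite rhoE exprMn z1 mul1r.
  apply: (pal (fun i => z ^+ i * (m.+2%:R - 2 * i%:R))).
  + exists 0%N => //; rewrite expr1 mulf_neq0 //.
    by rewrite mulr1 -natrB // subSS subn1.
  + rewrite rho2 expr_div_n; apply/negP => /eqP h.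
    have : m.+2%:R ^+ 2 = m%:R ^+ 2 :> F.
      by apply: (divIf (expf_neq0 2 m0)); rewrite h divff // expf_neq0.
    by rewrite -!natrX => /eqP; rewrite eqr_nat eqn_sqr => /eqP; lia.
  + split.
    * rewrite rhoE expr0 expr1 -!natr1.
      transitivity (z ^+ 2 * (m%:R + 1 + 1)); first by rewrite z1; ring.
      by field.
    * move=> i lei; rewrite natrB // mulrBr mulrA.
      have -> : z ^+ (m.+2 - i) = - eps * z ^+ i.
        rewrite -zm -[z ^+ m]mulr1 -z1 -exprD addn2 -{2}(subnK lei) exprD.
        by rewrite -mulrA sqr1_exprM // mulr1.
      rewrite -!natr1; ring.
    * move=> i lti.
      rewrite rho2 rhoE lamE (exprD z 2 i) z1 (exprS z i) -!natr1.
      by field.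
Qed.
(** The two powers of z span the solutions; multiplying X_i by z^i keeps the
exponents natural. *)
Lemma rec_geometric k z X : z != 0 -> z ^+ 2 != 1 ->
  (forall i, (i < k)%N -> z * (X i + X i.+2) = (z ^+ 2 + 1) * X i.+1) ->
  exists A B, forall i, (i <= k.+1)%N -> z ^+ i * X i = A * z ^+ (2 * i) + B.
Proof.
move=> z0 z1 recX.
have d0 : z ^+ 2 - 1 != 0 by rewrite subr_eq0.
pose A := (z * X 1%N - X 0%N) / (z ^+ 2 - 1).
pose B := (z ^+ 2 * X 0%N - z * X 1%N) / (z ^+ 2 - 1).
exists A, B => i lei.
suff [] : z ^+ i * X i = A * z ^+ (2 * i) + B /\ ((i < k.+1)%N ->
  z ^+ i.+1 * X i.+1 = A * z ^+ (2 * i.+1) + B) by [].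
elim: i lei => [|i IH] lei.
  by split=> [|_]; rewrite /A /B ?muln1 ?expr0 ?expr1; field.
have [IH0 IH1] := IH (ltnW lei); split=> [|lti]; first exact: IH1.
have rec := recX i lti.
apply: (lincomb3 (z ^+ i.+1) (- z ^+ 2) (z ^+ 2 + 1) rec IH0 (IH1 lei)).
by rewrite !mulnS !mul2n !exprD !exprS; ring.
Qed.

Lemma rec_arithmetic k z X : z ^+ 2 = 1 ->
  (forall i, (i < k)%N -> z * (X i + X i.+2) = (z ^+ 2 + 1) * X i.+1) ->
  exists A B, forall i, (i <= k.+1)%N -> X i = z ^+ i * (A + B * i%:R).
Proof.
move=> z2 recX.
pose A := X 0%N; pose B := z * X 1%N - X 0%N.
exists A, B => i lei.
suff [] : X i = z ^+ i * (A + B * i%:R) /\ ((i < k.+1)%N ->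
  X i.+1 = z ^+ i.+1 * (A + B * i.+1%:R)) by [].
elim: i lei => [|i IH] lei.
  split=> [|_]; rewrite /A /B ?expr0 ?expr1; first by ring.
  by apply: (lincomb1 (- X 1%N) z2); ring.
have [IH0 IH1] := IH (ltnW lei); split=> [|lti]; first exact: IH1.
have rec := recX i lti.
have zz k' : z ^+ k'.+2 = z ^+ k' by rewrite (exprD z 2) z2 mul1r.
have rec' : X i.+2 = 2 * z * X i.+1 - X i.
  by apply: (lincomb2 z (- (X i + X i.+2) + z * X i.+1) rec z2); ring.
rewrite rec' (IH1 lei) IH0 -[z ^+ i]zz !exprS -!natr1; ring.
Qed.

(** The last hypothesis is the first row of the eigenvalue equation. It is
there for the case rho = z with z^2 = 1: then the characteristic equation holds
for every lam, whose value has to come from the matrix itself. *)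
Lemma palindromic_curve n eps rho lam z X : (2 <= n)%N -> eps ^+ 2 = 1 ->
  rho != 0 -> lam != 0 -> z != 0 ->
  lam * rho * (z ^+ 2 + 1) = z * ((1 + rho ^+ 2) * lam - (1 - rho ^+ 2)) ->
  (exists2 k, (k < n)%N & X k.+1 != 0) ->
  palindromic_solution n eps rho lam X ->
  lam * X 1%N = \sum_(k < n) rho ^+ k * X k.+1 ->
  curve_point n eps rho lam z.
Proof.
move=> n2 eps2 rho0 lam0 z0 hz [k0 ltk0 Xk0] [X0 symX recX] sumX.
have recz i : (i < n)%N -> z * (X i + X i.+2) = (z ^+ 2 + 1) * X i.+1.
  move=> lti; apply: (mulfI (mulf_neq0 lam0 rho0)).
  by apply: (lincomb2 z (- X i.+1) (recX _ lti) hz); ring.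
have sym0 := symX 0%N isT; have sym1 := symX 1%N isT.
case: n n2 ltk0 symX recX sumX recz sym0 sym1 =>
  [//|m] m1 ltk0 symX recX sumX recz.
rewrite subn0 subSS subn0 => sym0 sym1.
have [z1|z1] := eqVneq (z ^+ 2) 1.
  have [A [B XE]] := rec_arithmetic z1 recz.
  have Xm1 := XE m.+1 (leqnSn _); have Xm2 := XE m.+2 (leqnn _).
  have XE0 := XE 0%N isT; have XE1 := XE 1%N isT.
  rewrite expr0 mulr0 addr0 mul1r in XE0; rewrite expr1 mulr1 in XE1.
  rewrite Xm2 XE0 in sym0; rewrite Xm1 XE1 in sym1; rewrite XE0 XE1 in X0.
  have zm1 : z ^+ m.+2 = z ^+ m by rewrite (exprD z 2) z1 mul1r.
  rewrite zm1 in sym0; rewrite exprS in sym1.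
  have {}sym1 : z ^+ m * (A + B * m.+1%:R) = eps * (A + B).
    by apply: (mulfI z0); apply: (lincomb1 1 sym1); ring.
  have : (eps * z ^+ m) ^+ 2 == 1 by rewrite exprMn eps2 mul1r expr2 sqr1_exprM.
  rewrite sqrf_eq1 => /orP[] /eqP s1.
    have sm : z ^+ m = eps by rewrite -[LHS]mul1r -eps2 expr2 -mulrA s1 mulr1.
    have eps0 : eps != 0 by rewrite -sqrf_eq0 eps2 oner_eq0.
    rewrite sm in sym0 sym1.
    have B0 : B = 0.
      have h := mulfI eps0 sym0.
      have m2 : m.+2%:R != 0 :> F by rewrite pnatr_eq0.
      by apply: (mulIf m2); apply: (lincomb1 1 h); ring.
    have A0 : A != 0.
      apply: contra Xk0; rewrite (XE _ (leqW ltk0)) B0 => /eqP ->.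
      by rewrite !mul0r addr0 mulr0.
    have rz : rho = z.
      have rz1 : rho * z = 1.
        by apply: (mulIf A0); apply: (lincomb1 (-1) X0); rewrite B0; ring.
      by apply: (lincomb2 z (- rho) rz1 z1); ring.
    apply: CurveRankOne => //.
    apply: (mulIf (mulf_neq0 z0 A0)); rewrite XE1 B0 addr0 in sumX.
    rewrite sumX (eq_bigr (fun=> z * A)) ?sumr_const ?card_ord ?mulr_natl //.
    move=> k _; rewrite (XE _ (leqW (ltn_ord k))) B0 mul0r addr0 rz exprS.
    by apply: (lincomb1 (z * A) (sqr1_exprM k z1)); ring.
  have sm : z ^+ m = - eps by rewrite -[LHS]mul1r -eps2 expr2 -mulrA s1 mulrN1.
  have eps0 : eps != 0 by rewrite -sqrf_eq0 eps2 oner_eq0.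
  have AB : 2 * A = - (m.+2%:R * B).
    apply: (mulfI eps0); rewrite sm in sym0.
    by apply: (lincomb1 (-1) sym0); ring.
  have B0 : B != 0.
    apply: contra Xk0 => /eqP B0; rewrite (XE _ (leqW ltk0)).
    move/eqP: AB; rewrite B0 mulr0 oppr0 mulf_eq0 pnatr_eq0 /= => /eqP ->.
    by rewrite mul0r addr0 mulr0.
  have m0 : m%:R != 0 :> F by rewrite pnatr_eq0 -lt0n.
  have rzm : rho * z * m%:R = m.+2%:R.
    apply: (mulIf B0).
    by apply: (lincomb2 2 (rho * z - 1) X0 AB); rewrite -!natr1; ring.
  have rE : rho = z * (m.+2%:R / m%:R).
    rewrite -rzm mulfK // mulrCA -[z * z]expr2 z1 mulr1 //.
  apply: CurveDouble => //.
  (* This is (1 - r)^2 for r = (n + 1) / (n - 1), the factor of lam in the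
     characteristic equation at rho = z r. *)
  have four : 4 / m%:R ^+ 2 != 0 :> F.
    by rewrite mulf_neq0 ?invr_neq0 ?expf_neq0 // pnatr_eq0.
  have hz' : z * (2 * lam * (m.+2%:R / m%:R)) =
      z * ((1 + (m.+2%:R / m%:R) ^+ 2) * lam - (1 - (m.+2%:R / m%:R) ^+ 2)).
    have -> : (m.+2%:R / m%:R) ^+ 2 = rho ^+ 2.
      by rewrite rE [RHS]exprMn z1 mul1r.
    by rewrite -hz z1 rE; ring.
  apply: (mulfI four); apply: (lincomb1 (-1) (mulfI z0 hz')).
  by rewrite -!natr1; field.
have [A [B XE]] := rec_geometric z0 z1 recz.
have Xm1 := XE m.+1 (leqnSn _); have Xm2 := XE m.+2 (leqnn _).
have XE0 := XE 0%N isT; have XE1 := XE 1%N isT.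
rewrite expr0 mul1r mulr1 in XE0; rewrite expr1 muln1 in XE1.
have e1 : z ^+ (2 * m.+1) = z ^+ 2 * (z ^+ m) ^+ 2.
  by rewrite mulnS exprD -exprM muln2 mul2n.
have e2 : z ^+ (2 * m.+2) = z ^+ 4 * (z ^+ m) ^+ 2.
  by rewrite !mulnS addnA exprD -exprM muln2 mul2n.
rewrite sym0 XE0 e2 !exprS in Xm2; rewrite sym1 e1 exprS in Xm1.
set a := z ^+ m in Xm1 Xm2 e1 e2.
(* The parity conditions at i = 0 and i = 1 share their first factor; the
   second factors cannot both vanish, as that would force z^2 = 1. *)
have P2 : (A * z ^+ 2 * a - eps * B) * (z ^+ 2 * a - eps) = 0.
  by apply: (lincomb2 (- 1) B Xm2 eps2); ring.
have P1 : (A * z ^+ 2 * a - eps * B) * (a - eps) = 0.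
  by apply: (lincomb3 (- 1) B (eps * a) Xm1 eps2 XE1); ring.
have BE : B = eps * A * z ^+ 2 * a.
  have /eqP P0 : A * z ^+ 2 * a - eps * B == 0.
    move: P1 P2 => /eqP; rewrite mulf_eq0 => /orP[// | /eqP/subr0_eq aE] /eqP.
    rewrite mulf_eq0 => /orP[// | /eqP/subr0_eq]; rewrite -aE => /eqP.
    rewrite -subr_eq0 -{2}[a]mul1r -mulrBl mulf_eq0 subr_eq0 (negPf z1).
    by rewrite expf_eq0 (negPf z0) andbF.
  by apply: (lincomb2 (- eps) (- B) P0 eps2); ring.
have A0 : A != 0.
  apply/eqP => A0; move/eqP: Xk0; apply.
  apply: (mulfI (expf_neq0 k0.+1 z0)); rewrite (XE _ (leqW ltk0)) BE A0; ring.
have r : rho * (z * (1 + eps * a)) = 1 + eps * (z * (z * a)).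
  apply: (mulfI (mulf_neq0 z0 A0)).
  by apply: (lincomb3 (- z) (- rho) z X0 XE1 XE0); rewrite BE; ring.
have D0 : 1 + eps * a != 0.
  apply: contra z1 => /eqP D0; rewrite D0 !mulr0 in r.
  by apply/eqP; apply: (lincomb2 1 (z ^+ 2) r D0); ring.
apply: CurveGeneric => //=; first by rewrite !exprS.
rewrite e1 -/a.
have d0 : eps * (z ^+ 2 - 1) != 0.
  by rewrite mulf_neq0 ?subr_eq0 // -sqrf_eq0 eps2 oner_eq0.
apply: (mulfI d0); apply/eqP; move: eps2 => /eqP.
rewrite sqrf_eq1 => /orP[] /eqP epsE;
  rewrite epsE in r *; apply/eqP.
- by apply: (lincomb2 ((1 + a) ^+ 2 * z) (- (lam * (1 + a) * (z ^+ 2 + 1)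
          - (lam + 1) * (rho * z * (1 + a) + (1 + z ^+ 2 * a)))) hz r); ring.
- by apply: (lincomb2 ((1 - a) ^+ 2 * z) (- (lam * (1 - a) * (z ^+ 2 + 1)
          - (lam + 1) * (rho * z * (1 - a) + (1 - z ^+ 2 * a)))) hz r); ring.
Qed.
End CurvePoint.

(** The two roots have product 1, so one of them lies in the closed unit
disc. *)
Lemma reciprocal_root (C : numClosedFieldType) (c : C) :
  exists z, [/\ z != 0, `|z| <= 1 & z ^+ 2 + 1 = c * z].
Proof.
pose d := sqrtC (c ^+ 2 - 4); have d2 : d ^+ 2 = c ^+ 2 - 4 by rewrite sqrtCK.
pose z := (c + d) / 2; pose z' := (c - d) / 2.
have zz' : z * z' = 1.
  by apply: (lincomb1 (- (1 / 4)) d2); rewrite /z /z'; field.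
have zP : z ^+ 2 + 1 = c * z by rewrite -zz' /z /z'; field.
have z'P : z' ^+ 2 + 1 = c * z' by rewrite -zz' /z /z'; field.
have z0 : z != 0.
  by apply: contra_eq_neq zz' => ->; rewrite mul0r eq_sym oner_eq0.
have z'0 : z' != 0.
  by apply: contra_eq_neq zz' => ->; rewrite mulr0 eq_sym oner_eq0.
have [le1|gt1] := real_leP (normr_real z) (real1 C); first by exists z.
exists z'; split=> //.
have /eqP := congr1 Num.norm zz'; rewrite normrM normr1 => /eqP h.
by rewrite -h ler_peMl ?normr_ge0 // ltW.
Qed.

(** * Eigenvalues of given parity *)

Section MatrixEigenvalues.
Context {R : realType}.
Implicit Types (rho lam eps z : R[i]).

Definition parity_eigenvalue n eps rho lam :=
  exists y : 'cV[R[i]]_n, eigenvector (Kmx n rho) lam y /\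
    forall j, y (rev_ord j) 0 = eps * y j 0.

Lemma type1_parity n rho lam :
  type1_eigenvalue n rho lam <-> parity_eigenvalue n (-1) rho lam.
Proof.
by split=> -[y [eigy symy]]; exists y; split=> // j; rewrite symy mulN1r.
Qed.

Lemma type2_parity n rho lam :
  type2_eigenvalue n rho lam <-> parity_eigenvalue n 1 rho lam.
Proof.
by split=> -[y [eigy symy]]; exists y; split=> // j; rewrite symy mul1r.
Qed.

Lemma parity_eigenvalueP n eps rho lam : (0 < n)%N ->
  parity_eigenvalue n eps rho lam <-> exists Y : nat -> R[i],
  [/\ exists2 k, (k < n)%N & Y k != 0,
    forall k, (k < n)%N -> Y (n.-1 - k)%N = eps * Y k &
    forall j, (j < n)%N -> \sum_(k < n) rho ^+ `|j - k|%N * Y k = lam * Y j].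
Proof.
case: n => [//|m] _; split=> [[y [[y0 eigy] symy]]|[Y [[k ltk Yk] symY eigY]]].
- exists (fun k => y (inord k) 0); split.
  + have [k yk] : exists k, y k 0 != 0.
      apply/existsP; apply: contraNT y0; rewrite negb_exists => /forallP y0.
      apply/eqP/matrixP=> i j; rewrite ord1 mxE; apply/eqP.
      by rewrite -[_ == _]negbK.
    by exists k; rewrite ?inord_val.
  + move=> k ltk; rewrite -symy; congr (y _ 0); apply: val_inj => /=.
    by rewrite !inordK ?ltnS ?leq_subr.
  + move=> j ltj; have /matrixP/(_ (inord j) 0) := eigy; rewrite !mxE => <-.
    apply: eq_bigr => k _; rewrite !mxE inord_val inordK //.
- exists (\col_j Y j); split.
    split.
      apply/eqP => /matrixP/(_ (Ordinal ltk) 0); rewrite !mxE /= => /eqP.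
      by rewrite (negPf Yk).
    apply/matrixP => j i; rewrite !mxE -eigY //.
    by apply: eq_bigr => l _; rewrite !mxE.
  by move=> j; rewrite !mxE -symY.
Qed.

(** Since |lam| = n >= 2, neither lam nor rho vanishes: for rho = 0 the matrix
is the identity. Hence the recurrence has the form X_i + X_(i+2) = c X_(i+1),
with reciprocal characteristic roots. *)
Lemma parity_eigenvalue_curve n eps rho lam : (2 <= n)%N -> eps ^+ 2 = 1 ->
  borderline n lam -> parity_eigenvalue n eps rho lam <->
  exists z, [/\ z != 0, `|z| <= 1 & curve_point n eps rho lam z].
Proof.
move=> n2 eps2 bl; have n0 : (0 < n)%N by lia.
have lam0 : lam != 0 by rewrite -normr_eq0 bl pnatr_eq0 -lt0n.
rewrite parity_eigenvalueP //.
split=> [[Y [[k ltk Yk] symY eigY]]|[z [z0 _]]]; last first.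
  exact: curve_point_eigen.
have rho0 : rho != 0.
  apply/negP => /eqP rho0; have := eigY _ ltk.
  rewrite (bigD1 (Ordinal ltk)) //= big1 ?addr0; last first.
    move=> i; rewrite -val_eqE /= => ik.
    by rewrite rho0 expr0n distn_eq0 eq_sym (negPf ik) mul0r.
  rewrite distnn expr0 => /(mulIf Yk) lam1.
  move: bl; rewrite /borderline -lam1 normr1 => /esym/eqP.
  by rewrite pnatr_eq1 => /eqP n1; rewrite n1 in n2.
have [X palX XY] := eigen_palindromic n0 eps2 symY eigY.
have [z [z0 z1 hz]] := reciprocal_root
  (((1 + rho ^+ 2) * lam - (1 - rho ^+ 2)) / (lam * rho)).
exists z; split=> //; apply: (@palindromic_curve _ n eps rho lam z X) => //.
- rewrite hz; field; exact/andP.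
- by exists k; rewrite ?XY.
- rewrite XY // -eigY //; apply: eq_bigr => i _.
  by rewrite dist0n XY.
Qed.
End MatrixEigenvalues.

(** * The equation for v(n, u) *)

Section HyperbolicEquation.
Context {R : realType}.
Implicit Types (u v x y a b : R).

Definition cosh x : R := (expR x + expR (- x)) / 2.

Lemma sinh0 : sinh 0 = 0 :> R.
Proof. by rewrite /sinh oppr0 subrr mul0r. Qed.

Lemma cosh_norm x : cosh `|x| = cosh x.
Proof. by rewrite /cosh; case: ger0P => // _; rewrite opprK addrC. Qed.

Lemma mul_sinh_cosh x y : 2 * (sinh y * cosh x) = sinh (x + y) - sinh (x - y).
Proof. by rewrite /sinh /cosh !opprD !opprK !expRD; field. Qed.

Lemma cosh_lt a b : 0 <= a -> a < b -> cosh a < cosh b.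
Proof.
move=> a0 ab; rewrite -subr_gt0.
have -> : cosh b - cosh a = (expR b - expR a) * (1 - expR (- (a + b))) / 2.
  rewrite opprD expRD /cosh.
  have ea : expR a * expR (- a) = 1 by rewrite -expRD subrr expR0.
  have eb : expR b * expR (- b) = 1 by rewrite -expRD subrr expR0.
  by apply: (lincomb2 (- expR (- b) / 2) (expR (- a) / 2) ea eb); field.
rewrite divr_gt0 // mulr_gt0 // subr_gt0 ?ltr_expR //.
rewrite -expR0 ltr_expR oppr_lt0; lra.
Qed.

Lemma cosh_le_norm a b : `|a| <= `|b| -> cosh a <= cosh b.
Proof.
rewrite -(cosh_norm a) -(cosh_norm b) le_eqVlt => /orP[/eqP -> //|ab].
by rewrite ltW // cosh_lt.
Qed.

Lemma cosh_ge1 x : 1 <= cosh x.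
Proof.
have <- : cosh 0 = 1 by rewrite /cosh oppr0 expR0; field.
by apply: cosh_le_norm; rewrite normr0.
Qed.

Lemma sinh_lt a b : a < b -> sinh a < sinh b.
Proof.
move=> ab; rewrite /sinh ltr_pM2r ?invr_gt0 // ltrB //.
- by rewrite ltr_expR.
- by rewrite ltr_expR ltrN2.
Qed.

Lemma sinh_ge0 a : 0 <= a -> 0 <= sinh a.
Proof. by rewrite -{2}sinh0 le_eqVlt => /orP[/eqP <-//|/sinh_lt/ltW]. Qed.

(** The quotient sinh (n v) / sinh v, written as a sum that makes sense at
v = 0 and in which every term is visibly nondecreasing for v >= 0. *)
Definition sinh_quot n v : R := \sum_(i < n) cosh ((n%:R - 1 - 2 * i%:R) * v).

(** Each product 2 sinh v cosh (m v) is a difference of hyperbolic sines, and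
the sum telescopes. *)
Lemma sinh_natmul n v : sinh (n%:R * v) = sinh v * sinh_quot n v.
Proof.
apply: (mulfI (_ : 2 != 0)) => //.
rewrite /sinh_quot !mulr_sumr.
under eq_bigr => i _ do rewrite mul_sinh_cosh.
rewrite -(big_mkord xpredT (fun i => sinh ((n%:R - 1 - 2 * i%:R) * v + v) -
  sinh ((n%:R - 1 - 2 * i%:R) * v - v))).
rewrite (telescope_sumr_eq (fun i => - sinh ((n%:R - 2 * i%:R) * v))) //.
  rewrite mulr0 subr0.
  have -> : (n%:R - 2 * n%:R) * v = - (n%:R * v) by ring.
  by rewrite /sinh !opprK; field.
move=> i _; rewrite opprK [RHS]addrC -natr1; by congr (sinh _ - sinh _); ring.
Qed.

Lemma sinh_quot_lt n a b : (2 <= n)%N -> 0 <= a -> a < b ->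
  sinh_quot n a < sinh_quot n b.
Proof.
case: n => [//|n] n2 a0 ab; rewrite /sinh_quot !big_ord_recl.
apply: ltr_leD; last first.
  apply: ler_sum => i _; apply: cosh_le_norm; rewrite !normrM ler_wpM2l //.
  rewrite !ger0_norm //; lra.
have n0 : 0 < n%:R :> R by rewrite ltr0n; lia.
rewrite /= mulr0 subr0 -natr1 addrK; apply: cosh_lt.
  by rewrite mulr_ge0 // ltW.
by rewrite ltr_pM2l.
Qed.

Lemma sinh_quot_ge n v : (2 <= n)%N -> 0 <= v ->
  n%:R + (cosh v - 1) <= sinh_quot n v.
Proof.
case: n => [//|n] n2 v0; rewrite /sinh_quot big_ord_recl -[n.+1%:R]natr1.
rewrite addrACA subrr addr0 addrC; apply: lerD.
  rewrite mulr0 subr0 addrK; apply: cosh_le_norm.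
  rewrite normrM ler_peMl // ger0_norm //.
  by rewrite ler1n; lia.
apply: le_trans (_ : \sum_(i < n) 1 <= _).
  by rewrite sumr_const card_ord.
by apply: ler_sum => i _; exact: cosh_ge1.
Qed.

Lemma sin_natmul_le n u : `|sin (n%:R * u)| <= n%:R * `|sin u|.
Proof.
elim: n => [|n IH]; first by rewrite !mul0r sin0 normr0.
rewrite -natr1 !mulrDl !mul1r sinD (le_trans (ler_normD _ _)) //.
rewrite !normrM lerD //.
  by rewrite (le_trans _ IH) // ler_piMr // ler_norml cos_geN1 cos_le1.
by rewrite ler_piMl // ler_norml cos_geN1 cos_le1.
Qed.

(** For n = 2 the factor |cos u| < 1 makes the inequality strict, and the
addition formula propagates strictness to larger n. *)
Lemma sin_natmul_lt n u : (2 <= n)%N -> sin u != 0 ->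
  `|sin (n%:R * u)| < n%:R * `|sin u|.
Proof.
move=> n2 su; have su0 : 0 < `|sin u| by rewrite normr_gt0.
have cu : `|cos u| < 1.
  rewrite -(ltr_pXn2r (_ : 0 < 2)%N) ?nnegrE // expr1n real_normK ?num_real //.
  have s2 : 0 < sin u ^+ 2 by rewrite exprn_even_gt0.
  have := cos2Dsin2 u; lra.
elim: n n2 => [//|n IH] n2; have [n2'|] := ltnP 1 n; last first.
  move=> n1; have -> : n = 1%N by lia.
  have -> : 2 * u = u *+ 2 by rewrite mulr_natl.
  rewrite mulr2n sinD [cos u * _]mulrC -mulr2n normrMn -[ltLHS]mulr_natl.
  by rewrite ltr_pM2l // normrM gtr_pMr.
rewrite -natr1 !mulrDl !mul1r sinD (le_lt_trans (ler_normD _ _)) //.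
rewrite !normrM ltr_leD //.
  by rewrite (le_lt_trans _ (IH n2')) // ler_piMr // ler_norml cos_geN1 cos_le1.
by rewrite ler_piMl // ler_norml cos_geN1 cos_le1.
Qed.

Lemma g_ge0 n u : 0 <= g_ n u.
Proof.
rewrite /g_ subr_ge0 -exprMn -[leLHS]real_normK ?num_real //.
rewrite -[leRHS]real_normK ?num_real //.
by rewrite ler_pXn2r ?nnegrE // normrM normr_nat sin_natmul_le.
Qed.

Lemma g_eq0 n u : (2 <= n)%N -> g_ n u = 0 -> sin u = 0.
Proof.
move=> n2 /eqP; apply: contraTeq => su; rewrite gt_eqF //.
rewrite /g_ subr_gt0 -exprMn -[ltLHS]real_normK ?num_real //.
rewrite -[ltRHS]real_normK ?num_real //.
by rewrite ltr_pXn2r ?nnegrE // normrM normr_nat sin_natmul_lt.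
Qed.

Definition sinh_gap n v : R := sinh (n%:R * v) ^+ 2 - n%:R ^+ 2 * sinh v ^+ 2.

Lemma sinh_gapE n v :
  sinh_gap n v = sinh v ^+ 2 * (sinh_quot n v ^+ 2 - n%:R ^+ 2).
Proof. by rewrite /sinh_gap sinh_natmul; ring. Qed.

Lemma sinh_gap_lt n a b : (2 <= n)%N -> 0 <= a -> a < b ->
  sinh_gap n a < sinh_gap n b.
Proof.
move=> n2 a0 ab; rewrite !sinh_gapE.
have q_ge c : 0 <= c -> n%:R <= sinh_quot n c.
  move=> c0; apply: le_trans (sinh_quot_ge n2 c0).
  by rewrite lerDl subr_ge0 cosh_ge1.
have n0 : 0 <= n%:R :> R by [].
have qa := q_ge _ a0; have qab := sinh_quot_lt n2 a0 ab.
apply: ltr_pM.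
- by rewrite sqr_ge0.
- by rewrite subr_ge0 ler_pXn2r ?nnegrE // (le_trans n0).
- by rewrite ltr_pXn2r ?nnegrE ?sinh_ge0 ?sinh_lt // ltW // (le_lt_trans a0).
- by rewrite ltrD2r ltr_pXn2r ?nnegrE // ?(le_trans n0) // (le_trans qa) ?ltW.
Qed.

(** A crude growth bound that locates a root: for v >= 4 the estimate
sinh v >= v / 2 already gives sinh^2 v >= v, and the other factor is at least 1. *)
Lemma sinh_gap_ge n v : (2 <= n)%N -> 4 <= v -> v <= sinh_gap n v.
Proof.
move=> n2 v4; have v0 : 0 <= v by lra.
have n2' : 2 <= n%:R :> R by rewrite (ler_nat R 2).
have qn := sinh_quot_ge n2 v0.
have e1 : 1 + v <= expR v := expR_ge1Dx v.
have e0 : 0 < expR (- v) := expR_gt0 _.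
have e2 : expR (- v) <= 1 by rewrite -expR0 ler_expR oppr_le0.
have sv : v / 2 <= sinh v by rewrite /sinh; lra.
have cv : 1 + 1 <= cosh v by rewrite /cosh; lra.
have s2 : v <= sinh v ^+ 2 by nra.
have q2 : 1 <= sinh_quot n v ^+ 2 - n%:R ^+ 2 by nra.
by rewrite sinh_gapE (le_trans s2) // ler_peMr // sqr_ge0.
Qed.

Lemma sinh_gap_continuous n : continuous (sinh_gap n).
Proof.
have sc c : continuous (fun v : R => sinh (c * v)).
  move=> v; rewrite /sinh; apply: cvgM; last exact: cvg_cst.
  apply: cvgB; (apply: continuous_comp; last exact: continuous_expR).
    by apply: cvgM; [exact: cvg_cst|exact: cvg_id].
  by apply: cvgN; apply: cvgM; [exact: cvg_cst|exact: cvg_id].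
have s1 : continuous (@sinh R).
  rewrite (_ : sinh = fun v => sinh (1 * v)); first exact: sc.
  by apply/funext => v; rewrite mul1r.
move=> v; apply: cvgB; first by apply: cvgM; exact: sc.
by apply: cvgM; [exact: cvg_cst|apply: cvgM; exact: s1].
Qed.

Lemma v_root_exists_unique n u : (2 <= n)%N -> exists! v, v_root n u v.
Proof.
move=> n2; have g0 := g_ge0 n u.
have gap0 : sinh_gap n 0 = 0.
  by rewrite /sinh_gap mulr0 sinh0 expr0n mulr0 subr0.
have [v] : exists2 v, v \in `[0, 4 + g_ n u] & sinh_gap n v = g_ n u.
  apply: IVT; first by lra.
    exact/continuous_subspaceT/sinh_gap_continuous.
  have hge : 4 + g_ n u <= sinh_gap n (4 + g_ n u).
    by apply: sinh_gap_ge => //; lra.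
  by rewrite gap0 ge_min g0 /= le_max (le_trans _ hge) ?orbT //; lra.
rewrite in_itv /= => /andP[v0 _] gv; exists v; split=> [//|w [w0 gw]].
by case: (ltgtP v w) => // /(sinh_gap_lt n2); rewrite ?v0 ?w0 => /(_ isT);
  rewrite gv -[sinh_gap n w]/(_ - _) gw ltxx.
Qed.

End HyperbolicEquation.

(** * The complex exponential *)

Section ComplexExponential.
Local Open Scope complex_scope.
Context {R : realType}.
Implicit Types (u v : R) (w z : R[i]).

Lemma cexpD z w : cexp (z + w) = cexp z * cexp w.
Proof.
case: z w => [a b] [c d]; rewrite /cexp /= expRD cosD sinD.
by apply/eqP; rewrite eq_complex /=; apply/andP; split; apply/eqP; ring.
Qed.

Lemma cexp0 : cexp 0 = 1 :> R[i].
Proof. by rewrite /cexp /= expR0 cos0 sin0 mulr1 mulr0. Qed.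

Lemma cexp_neq0 z : cexp z != 0.
Proof.
have : cexp z * cexp (- z) = 1 by rewrite -cexpD subrr cexp0.
by apply: contra_eq_neq => ->; rewrite mul0r eq_sym oner_eq0.
Qed.

Lemma cexpN z : cexp (- z) = (cexp z)^-1.
Proof.
by apply: (mulfI (cexp_neq0 z)); rewrite mulfV ?cexp_neq0 // -cexpD subrr cexp0.
Qed.

Lemma cexp_natmul n z : cexp (n%:R * z) = cexp z ^+ n.
Proof.
elim: n => [|n IH]; first by rewrite mul0r cexp0 expr0.
by rewrite -natr1 mulrDl mul1r cexpD IH exprSr.
Qed.

Definition cis w : R[i] := cexp ('i * w).

Lemma mul_i_complex u v : 'i * (u +i* v) = (- v) +i* u :> R[i].
Proof.
rewrite -complexiE; apply/eqP.
by rewrite eq_complex /= !mul0r !mul1r sub0r add0r !eqxx.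
Qed.

Lemma cisE u v : cis (u +i* v) = (expR (- v) * cos u) +i* (expR (- v) * sin u).
Proof. by rewrite /cis mul_i_complex. Qed.

Lemma cis_neq0 w : cis w != 0. Proof. exact: cexp_neq0. Qed.

Lemma cisD z w : cis (z + w) = cis z * cis w.
Proof. by rewrite /cis mulrDr cexpD. Qed.

Lemma cisN w : cis (- w) = (cis w)^-1.
Proof. by rewrite /cis mulrN cexpN. Qed.

Lemma cis_natmul n w : cis (n%:R * w) = cis w ^+ n.
Proof. by rewrite /cis mulrCA cexp_natmul. Qed.

Lemma norm_complexE u v : `|u +i* v| ^+ 2 = (u ^+ 2 + v ^+ 2)%:C :> R[i].
Proof. by rewrite -add_Re2_Im2. Qed.

Lemma norm_cis u v : `|cis (u +i* v)| = (expR (- v))%:C.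
Proof.
apply/eqP; rewrite -(eqrXn2 (_ : 0 < 2)%N) ?normr_ge0 ?ler0c ?expR_ge0 //.
rewrite cisE norm_complexE -rmorphXn /=; apply/eqP; congr (_%:C).
by rewrite !exprMn -mulrDr cos2Dsin2 mulr1.
Qed.

Lemma cis_surj z : z != 0 ->
  exists u v, - pi <= u <= pi /\ cis (u +i* v) = z.
Proof.
case: z => [x y] z0.
pose r : R := Num.sqrt (x ^+ 2 + y ^+ 2).
have r2 : r ^+ 2 = x ^+ 2 + y ^+ 2 by rewrite sqr_sqrtr // addr_ge0 // sqr_ge0.
have r0 : 0 < r.
  rewrite lt_def sqrtr_ge0 andbT -sqrf_eq0 r2 paddr_eq0 ?sqr_ge0 // !sqrf_eq0.
  by move: z0; rewrite eq_complex.
have xr : (x / r) ^+ 2 + (y / r) ^+ 2 = 1.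
  by rewrite !expr_div_n -mulrDl -r2 divff // expf_neq0 // gt_eqF.
have xr1 : -1 <= x / r <= 1.
  rewrite -ler_norml -(ler_pXn2r (_ : 0 < 2)%N) ?nnegrE //.
  by rewrite expr1n real_normK ?num_real // -xr lerDl sqr_ge0.
pose t := acos (x / r).
have ct : cos t = x / r by rewrite acosK.
have st : sin t = `|y / r|.
  rewrite /t sin_acos // -sqrtr_sqr; congr Num.sqrt; lra.
have t0 : 0 <= t by exact: acos_ge0.
have tpi : t <= pi by exact: acos_lepi.
have er : expR (- - ln r) = r by rewrite opprK lnK.
pose u := if 0 <= y then t else - t.
exists u, (- ln r); split; first by rewrite /u; case: ifP => _; lra.
have -> : cis (u +i* - ln r) = (r * cos u) +i* (r * sin u) by rewrite cisE er.
have rr : r != 0 by rewrite gt_eqF.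
have nr : `|y / r| = `|y| / r by rewrite normf_div (gtr0_norm r0).
rewrite /u; case: ifPn => y0; rewrite ?cosN ?sinN ct st nr.
  by rewrite ger0_norm // !(mulrC r) !divfK.
rewrite ltr0_norm ?ltNge //.
by rewrite mulNr opprK !(mulrC r) !divfK.
Qed.

(** Local injectivity: the nearest nonzero period has modulus 2 pi > 1. *)
Lemma cis_eq1 w : `|w| < 1 -> cis w = 1 -> w = 0.
Proof.
case: w => [u v] w1; rewrite cisE => -[h1 h2].
have u1 : `|u| < 1.
  by rewrite -ltcR; apply: le_lt_trans w1; exact: (normc_ge_Re (u +i* v)).
have e0 := expR_gt0 (- v).
have su : sin u = 0 by apply/eqP; move/eqP: h2; rewrite mulf_eq0 gt_eqF.
have u0 : u = 0.
  have pi2 := pi_ge2 R; move: u1; rewrite ltr_norml => /andP[u1 u2].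
  case: (ltgtP u 0) => // u0.
  + have : 0 < sin (- u) by apply: sin_gt0_pi; lra.
    by rewrite sinN su oppr0 ltxx.
  + have : 0 < sin u by apply: sin_gt0_pi; lra.
    by rewrite su ltxx.
move: h1; rewrite u0 cos0 mulr1 -expR0 => /expR_inj/eqP.
by rewrite oppr_eq0 => /eqP ->.
Qed.

Lemma csinE w : csin w = (cis w - (cis w)^-1) / (2 * 'i).
Proof. by rewrite /csin -/(cis w) cexpN. Qed.

Lemma ccosE w : ccos w = (cis w + (cis w)^-1) / 2.
Proof. by rewrite /ccos -/(cis w) cexpN. Qed.

Lemma norm_csin u v : `|csin (u +i* v)| ^+ 2 = (sin u ^+ 2 + sinh v ^+ 2)%:C.
Proof.
have -> : csin (u +i* v) = (sin u * cosh v) +i* (cos u * sinh v).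
  have i0 : 2 * 'i != 0 :> R[i] by rewrite mulf_neq0 ?pnatr_eq0 ?neq0Ci.
  apply: (mulIf i0); rewrite /csin divfK // -/(cis _).
  have -> : cexp (- ('i * (u +i* v))) = cis ((- u) +i* (- v)).
    by rewrite /cis -mulrN.
  rewrite !cisE cosN sinN opprK [_ * (2 * _)]mulrC -mulrA mul_i_complex.
  apply/eqP; rewrite mulr_natl mulr2n eq_complex /= /cosh /sinh.
  by apply/andP; split; apply/eqP; field.
rewrite norm_complexE; congr (_%:C).
have := cos2Dsin2 u; have : cosh v ^+ 2 = 1 + sinh v ^+ 2.
  have ev : expR v * expR (- v) = 1 by rewrite -expRD subrr expR0.
  by rewrite /cosh /sinh; apply: (lincomb1 1 ev); field.
rewrite !exprMn => -> /(canRL (addrK _)) ->; ring.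
Qed.
End ComplexExponential.

(** * Removable singularities *)

Section PowerQuotients.
Local Open Scope classical_set_scope.
Variable K : numFieldType.
Implicit Types s : K.

Lemma cvg_exprn (F : set_system K^o) (FF : Filter F) (Z : K^o -> K^o)
    (z : K^o) p :
  Z @ F --> z -> (fun w => Z w ^+ p : K^o) @ F --> (z ^+ p : K^o).
Proof.
move=> Zz; elim: p => [|p IH].
  by rewrite expr0; under eq_fun do rewrite expr0; exact: cvg_cst.
by rewrite exprS; under eq_fun do rewrite exprS; apply: cvgM.
Qed.

(** The sum is the quotient of Z^p - z^p by Z - z. *)
Lemma cvg_divided_power (F : set_system K^o) (FF : Filter F) (Z : K^o -> K^o)
    (z : K^o) p : Z @ F --> z ->
  (fun w => \sum_(i < p) Z w ^+ (p.-1 - i) * z ^+ i : K^o) @ F -->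
    (p%:R * z ^+ p.-1 : K^o).
Proof.
move=> Zz.
have -> : p%:R * z ^+ p.-1 = \sum_(i < p) z ^+ (p.-1 - i) * z ^+ i :> K^o.
  rewrite (eq_bigr (fun=> z ^+ p.-1)) ?sumr_const ?card_ord ?mulr_natl //.
  by move=> i _; rewrite -exprD subnK // -ltnS (ltn_predK (ltn_ord i)).
elim: (index_enum _) => [|i r IH].
  by rewrite big_nil; under eq_fun do rewrite big_nil; exact: cvg_cst.
rewrite big_cons; under eq_fun do rewrite big_cons.
by apply: cvgD => //; apply: cvgM; [exact: cvg_exprn|exact: cvg_cst].
Qed.

(** Off the point w0 the factor Z w - Z w0 is nonzero and cancels, and what is
left of the numerator and of the denominator is continuous at w0. *)
Lemma lim_power_quotient (num den A B Z : K^o -> K^o) s p q k (w0 : K^o) :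
  (0 < q)%N -> Z w0 != 0 ->
  (forall w, num w = A w * (Z w ^+ p - s)) ->
  (forall w, den w = B w * (Z w ^+ q - s)) ->
  (forall w, A w / B w = (Z w ^+ k)^-1) ->
  Z w0 ^+ p = s -> Z w0 ^+ q = s ->
  {for w0, continuous Z} -> (\forall w \near w0^', Z w != Z w0) ->
  lim ((fun w => num w / den w : K^o) @ w0^') =
    p%:R * Z w0 ^+ p.-1 / (Z w0 ^+ k * (q%:R * Z w0 ^+ q.-1)).
Proof.
move=> q0 Z0 numE denE ABE Zp Zq contZ nearZ.
apply: cvg_lim; first exact: norm_hausdorff.
have ZZ : Z @ w0^' --> Z w0 by apply/continuous_withinNx.
have G : (fun w => (\sum_(i < p) Z w ^+ (p.-1 - i) * Z w0 ^+ i) /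
    (Z w ^+ k * (\sum_(i < q) Z w ^+ (q.-1 - i) * Z w0 ^+ i)) : K^o) @ w0^' -->
    (p%:R * Z w0 ^+ p.-1 / (Z w0 ^+ k * (q%:R * Z w0 ^+ q.-1)) : K^o).
  apply: cvgM; first exact: cvg_divided_power.
  apply: cvgV.
    by rewrite !mulf_neq0 ?expf_neq0 // pnatr_eq0 -lt0n.
  by apply: cvgM; [exact: cvg_exprn|exact: cvg_divided_power].
apply: cvg_trans G; apply: near_eq_cvg; apply: filterS nearZ => w Zw.
have d0 : Z w - Z w0 != 0 by rewrite subr_eq0.
rewrite numE denE -[_ ^+ p - s]/(_ - _) -{1}Zp -{1}Zq !subrXX.
set S1 := \sum_(i < p) _; set S2 := \sum_(i < q) _.
rewrite [in RHS]invfM mulrACA ABE [in RHS]invfM mulrACA divff // mul1r.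
by rewrite invfM mulrCA.
Qed.

End PowerQuotients.

Section RemovableSingularities.
Local Open Scope classical_set_scope.
Local Open Scope complex_scope.
Context {R : realType}.
Notation C := (R[i]^o).

Lemma Re_continuous : continuous (fun w : C => complex.Re w : R).
Proof.
move=> w; have FF : Filter (nbhs (w : C)) by exact: nbhs_filter.
apply/(@cvgrPdist_lt _ _ _ _ FF) => e e0.
exists e%:C; rewrite /= ?ltcR // => z wz; rewrite -ltcR.
apply: le_lt_trans wz.
have -> : complex.Re w - complex.Re z = complex.Re (w - z : R[i]).
  by case: (w) (z) => [? ?] [? ?].
exact: normc_ge_Re.
Qed.

Lemma Im_continuous : continuous (fun w : C => complex.Im w : R).
Proof.
have -> : (fun w : C => complex.Im w) =
    (fun w : C => complex.Re (- 'i * w : R[i])).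
  by apply/funext => -[a b]; rewrite mulNr mul_i_complex /= opprK.
move=> w; have FF : Filter (nbhs (w : C)) by exact: nbhs_filter.
apply: (@continuous_comp C C R (fun w : C => - 'i * w : C)
  (fun w : C => complex.Re w : R)).
  by apply: cvgM; [exact: cvg_cst|exact: cvg_id].
exact: Re_continuous.
Qed.

Lemma real_complex_continuous : continuous (fun x : R => x%:C : C).
Proof.
move=> x; apply/cvgrPdist_lt => e e0.
have [e' ee] : exists e', e = e'%:C by apply/complex_realP; rewrite gtr0_real.
have e'0 : 0 < e' by rewrite -ltcR -ee.
apply/nbhs_normP; exists e' => //= y xy.
by rewrite -rmorphB /= normc_def /= expr0n addr0 sqrtr_sqr ee ltcR.
Qed.

Lemma cis_continuous : continuous (fun w : C => cis w : C).
Proof.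
have -> : (fun w : C => cis w : C) = (fun w : C =>
   (expR (- complex.Im w) * cos (complex.Re w))%:C +
   'i * (expR (- complex.Im w) * sin (complex.Re w))%:C : C).
  apply/funext => -[a b]; rewrite cisE mul_i_complex /=.
  by apply/eqP; rewrite eq_complex /= oppr0 addr0 add0r !eqxx.
move=> w; have FF : Filter (nbhs (w : C)) by exact: nbhs_filter.
have ex : (fun w : C => expR (- complex.Im w) : R) @ w -->
    expR (- complex.Im w).
  apply: (@continuous_comp C R R (fun w : C => - complex.Im w : R));
    last exact: continuous_expR.
  by apply: cvgN; exact: Im_continuous.
apply: cvgD; last (apply: cvgM; first exact: cvg_cst).
  apply: (@continuous_comp C R C _ (fun x : R => x%:C : C));
    last exact: real_complex_continuous.
  apply: cvgM => //.
  apply: (@continuous_comp C R R (fun w : C => complex.Re w)).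
    exact: Re_continuous.
  exact: continuous_cos.
apply: (@continuous_comp C R C _ (fun x : R => x%:C : C));
  last exact: real_complex_continuous.
apply: cvgM => //.
apply: (@continuous_comp C R R (fun w : C => complex.Re w)).
  exact: Re_continuous.
exact: continuous_sin.
Qed.

Lemma cis_near_neq (w0 : C) : \forall w \near w0^', cis w != cis w0.
Proof.
exists 1; rewrite //= => w ww0 w_neq; apply: contra w_neq => /eqP e.
rewrite eq_sym -subr_eq0; apply/eqP; apply: cis_eq1 => //.
by rewrite cisD cisN e divff // cis_neq0.
Qed.

(** The quotients of sines and cosines that define the curves have this form in
z = e^(i w): the nowhere vanishing factors A and B are powers of e^(i w/2) up
to constants, and their ratio is a power of z. *)
Lemma removable_quot_cis (num den A B : R[i] -> R[i]) s p q k w0 :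
  (0 < q)%N -> (forall w, A w != 0) -> (forall w, B w != 0) ->
  (forall w, num w = A w * (cis w ^+ p - s)) ->
  (forall w, den w = B w * (cis w ^+ q - s)) ->
  (forall w, A w / B w = (cis w ^+ k)^-1) ->
  removable_quot num den w0 =
  if (cis w0 ^+ p == s) && (cis w0 ^+ q == s)
  then p%:R * cis w0 ^+ p.-1 / (cis w0 ^+ k * (q%:R * cis w0 ^+ q.-1))
  else (cis w0 ^+ p - s) / (cis w0 ^+ k * (cis w0 ^+ q - s)).
Proof.
move=> q0 A0 B0 numE denE ABE; rewrite /removable_quot numE denE.
rewrite !mulf_eq0 (negPf (A0 _)) (negPf (B0 _)) /= !subr_eq0.
case: ifP => [/andP[/eqP Zp /eqP Zq]|_].
  apply: (@lim_power_quotient _ num den A B (fun w => cis w) s p q k w0) => //.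
  - exact: cis_neq0.
  - exact: cis_continuous.
  - exact: cis_near_neq.
by rewrite invfM mulrACA ABE invfM mulrCA.
Qed.

End RemovableSingularities.

(** * The two curves *)

Section Curves.
Local Open Scope complex_scope.
Context {R : realType}.
Implicit Types (u v : R) (w rho lam eps : R[i]).

Lemma cis_half w : cis w = cis (w / 2) ^+ 2.
Proof. by rewrite -cis_natmul; congr cis; field. Qed.

Lemma csin_half_natmul m w :
  csin (m%:R * (w / 2)) = (cis (w / 2) ^+ m)^-1 / (2 * 'i) * (cis w ^+ m - 1).
Proof.
have W0 : cis (w / 2) ^+ m != 0 by rewrite expf_neq0 // cis_neq0.
rewrite csinE cis_natmul [RHS]mulrAC; congr (_ / _).
rewrite (cis_half w) exprAC.
by rewrite mulrBr expr2 mulKf // mulr1.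
Qed.

Lemma ccos_half_natmul m w :
  ccos (m%:R * (w / 2)) = (cis (w / 2) ^+ m)^-1 / 2 * (cis w ^+ m - (-1)).
Proof.
have W0 : cis (w / 2) ^+ m != 0 by rewrite expf_neq0 // cis_neq0.
rewrite ccosE cis_natmul [RHS]mulrAC; congr (_ / _).
rewrite (cis_half w) exprAC.
by rewrite opprK mulrDr expr2 mulKf // mulr1.
Qed.

Lemma half_power_ratio n w c : (0 < n)%N -> c != 0 ->
  (cis (w / 2) ^+ n.+1)^-1 / c / ((cis (w / 2) ^+ n.-1)^-1 / c) =
    (cis w ^+ 1)^-1.
Proof.
move=> n0 c0; have W0 := cis_neq0 (w / 2); rewrite expr1 (cis_half w).
by case: n n0 => //= n _; rewrite !exprS; field; rewrite W0 c0 expf_neq0.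
Qed.

(** The common form of the two curves for rho: in terms of e^(i w),
sin ((n+1) w/2) / sin ((n-1) w/2) is the quotient below for eps = -1, and the
quotient of cosines is the one for eps = 1. It is the value of rho forced by
the boundary condition, with its limit where both parts vanish. *)
Definition boundary_ratio eps n w : R[i] :=
  if (cis w ^+ n.+1 == - eps) && (cis w ^+ n.-1 == - eps)
  then n.+1%:R * cis w ^+ n / (cis w * (n.-1%:R * cis w ^+ n.-2))
  else (cis w ^+ n.+1 + eps) / (cis w * (cis w ^+ n.-1 + eps)).

Let two_i_neq0 : 2 * 'i != 0 :> R[i].
Proof. by rewrite mulf_neq0 ?pnatr_eq0 ?neq0Ci. Qed.

Lemma f1E n u : (2 <= n)%N -> f1 n u = boundary_ratio (-1) n (mu_ n u).
Proof.
move=> n2; rewrite /f1 (@removable_quot_cis _ _ _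
  (fun w => (cis (w / 2) ^+ n.+1)^-1 / (2 * 'i))
  (fun w => (cis (w / 2) ^+ n.-1)^-1 / (2 * 'i)) 1 n.+1 n.-1 1).
- by rewrite /boundary_ratio opprK expr1.
- by lia.
- by move=> w; rewrite mulf_neq0 ?invr_eq0 ?expf_neq0 ?cis_neq0.
- by move=> w; rewrite mulf_neq0 ?invr_eq0 ?expf_neq0 ?cis_neq0.
- by move=> w; rewrite -csin_half_natmul -(natr1 n) mulrA.
- move=> w; rewrite -csin_half_natmul mulrA; congr csin; congr (_ * _ / _).
  by rewrite -subn1 natrB //; lia.
- by move=> w; rewrite half_power_ratio //; lia.
Qed.

Lemma f2E n u : (2 <= n)%N -> f2 n u = boundary_ratio 1 n (mu_ n u).
Proof.
have c2 : 2 != 0 :> R[i] by rewrite pnatr_eq0.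
move=> n2; rewrite /f2 (@removable_quot_cis _ _ _
  (fun w => (cis (w / 2) ^+ n.+1)^-1 / 2)
  (fun w => (cis (w / 2) ^+ n.-1)^-1 / 2) (-1) n.+1 n.-1 1).
- by rewrite /boundary_ratio opprK expr1.
- by lia.
- by move=> w; rewrite mulf_neq0 ?invr_eq0 ?expf_neq0 ?cis_neq0.
- by move=> w; rewrite mulf_neq0 ?invr_eq0 ?expf_neq0 ?cis_neq0.
- by move=> w; rewrite -ccos_half_natmul -(natr1 n) mulrA.
- move=> w; rewrite -ccos_half_natmul mulrA; congr ccos; congr (_ * _ / _).
  by rewrite -subn1 natrB //; lia.
- by move=> w; rewrite half_power_ratio //; lia.
Qed.

Lemma csin_natmul m w :
  csin (m%:R * w) = (cis w ^+ m)^-1 / (2 * 'i) * (cis w ^+ (2 * m) - 1).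
Proof.
have W0 : cis w ^+ m != 0 by rewrite expf_neq0 // cis_neq0.
rewrite csinE cis_natmul mulnC exprM [RHS]mulrAC; congr (_ / _).
by rewrite mulrBr expr2 mulKf // mulr1.
Qed.

Lemma b2E n u : (2 <= n)%N -> b2 n u =
  if (cis (mu_ n u) ^+ (2 * n) == 1) && (cis (mu_ n u) ^+ 2 == 1)
  then (2 * n)%:R * cis (mu_ n u) ^+ (2 * n).-1 /
    (cis (mu_ n u) ^+ n.-1 * (2 * cis (mu_ n u)))
  else (cis (mu_ n u) ^+ (2 * n) - 1) /
    (cis (mu_ n u) ^+ n.-1 * (cis (mu_ n u) ^+ 2 - 1)).
Proof.
move=> n2; rewrite /b2 (@removable_quot_cis _ _ _
  (fun w => (cis w ^+ n)^-1 / (2 * 'i))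
  (fun w => (cis w ^+ 1)^-1 / (2 * 'i)) 1 (2 * n) 2 n.-1) //.
- by move=> w; rewrite mulf_neq0 ?invr_eq0 ?expf_neq0 ?cis_neq0.
- by move=> w; rewrite mulf_neq0 ?invr_eq0 ?expf_neq0 ?cis_neq0.
- by move=> w; rewrite -csin_natmul.
- by move=> w; rewrite -[in LHS](mul1r w) (csin_natmul 1).
- move=> w; have W0 := cis_neq0 w.
  case: n n2 => //= n _; rewrite !exprS expr0; field.
  by rewrite W0 neq0Ci expf_neq0.
Qed.

Lemma b1E n u : b1 n u = - b2 n u. Proof. by []. Qed.

Lemma v_rootP n u : (2 <= n)%N -> v_root n u (v_ n u).
Proof.
move=> n2; have [v [vr _]] := v_root_exists_unique u n2.
by rewrite /v_; case: xgetP => [_ -> //|/(_ v)]; case.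
Qed.

Lemma v_rootE n u v : (2 <= n)%N -> v_root n u v -> v_ n u = v.
Proof.
move=> n2 vr; have [v' [_ uniq]] := v_root_exists_unique u n2.
by rewrite -(uniq _ vr); apply/esym/uniq/v_rootP.
Qed.

(** For v = 0 the equation reads g_n(u) = 0, which forces sin u = 0. *)
Lemma v_root_gt0 n u v : (2 <= n)%N -> v_root n u v ->
  cis (u +i* v) ^+ 2 != 1 -> 0 < v.
Proof.
move=> n2 [v0 vr] z1; rewrite lt_def v0 andbT; apply: contra z1 => /eqP ve.
move: vr; rewrite ve mulr0 sinh0 expr0n mulr0 subr0 => /esym/(g_eq0 n2) su.
have c1 : cos u ^+ 2 = 1 by have := cos2Dsin2 u; rewrite su expr0n addr0.
by rewrite cisE oppr0 expR0 su mulr0 mul1r complexr0 -rmorphXn /= c1.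
Qed.

(** If z^2 <> 1 then v > 0, so |z| < 1 and z^(n-1) + eps does not vanish. If
z^2 = 1, the quotient for lam is always 0/0, and that for rho is 0/0 exactly
when eps z^(n-1) = -1. *)
Lemma boundary_ratio_curve eps n u : (2 <= n)%N -> eps ^+ 2 = 1 ->
  curve_point n eps (boundary_ratio eps n (mu_ n u)) (eps * b2 n u)
    (cis (mu_ n u)).
Proof.
move=> n2 eps2; rewrite b2E // /boundary_ratio.
have vr := v_rootP u n2.
have z0 : cis (mu_ n u) != 0 by exact: cis_neq0.
have [z1|z1] := eqVneq (cis (mu_ n u) ^+ 2) 1; last first.
  have v0 := v_root_gt0 n2 vr z1.
  have D0 : cis (mu_ n u) ^+ n.-1 + eps != 0.
    apply/negP; rewrite addr_eq0 => /eqP h.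
    have : `|cis (mu_ n u)| ^+ (2 * n.-1) = 1.
      by rewrite -normrX mulnC exprM h sqrrN eps2 normr1.
    rewrite norm_cis; move/eqP; rewrite pexpr_eq1 ?ler0c ?expR_ge0 //; last lia.
    move=> /eqP [] /eqP; rewrite -expR0 (inj_eq (@expR_inj R)) oppr_eq0.
    by rewrite gt_eqF.
  have DN : (cis (mu_ n u) ^+ n.-1 == - eps) = false.
    by rewrite -addr_eq0 (negPf D0).
  rewrite DN !andbF.
  have epsD x : 1 + eps * x = eps * (x + eps).
    by rewrite mulrDr -expr2 eps2 addrC.
  have eps0 : eps != 0 by rewrite -sqrf_eq0 eps2 oner_eq0.
  apply: CurveGeneric => //.
  - by rewrite epsD mulf_neq0.
  - by rewrite !epsD; field; rewrite z0 D0.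
  - by rewrite -mulrA divfK // mulf_neq0 ?expf_neq0 // subr_eq0.
have eps0 : eps != 0 by rewrite -sqrf_eq0 eps2 oner_eq0.
have epsN : (eps == - eps) = false.
  apply/negbTE; rewrite -subr_eq0 opprK -mulr2n -mulr_natl mulf_eq0 negb_or.
  by rewrite pnatr_eq0.
set z := cis _ in z0 z1 *.
have z2n : z ^+ (2 * n) = 1 by rewrite exprM z1 expr1n.
have z2n1 : z ^+ (2 * n).-1 = z.
  apply: (mulIf z0); rewrite -exprSr prednK ?z2n -?expr2 ?z1 //; lia.
rewrite z2n eqxx /= z2n1.
have : (eps * z ^+ n.-1) ^+ 2 == 1.
  by rewrite exprMn eps2 mul1r expr2 sqr1_exprM.
have zn1 : z ^+ n.+1 = z ^+ n.-1.
  by rewrite -[RHS]mul1r -z1 -exprD; congr (_ ^+ _); lia.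
have n0 : n%:R != 0 :> R[i] by rewrite pnatr_eq0; lia.
have nP0 : n.-1%:R != 0 :> R[i] by rewrite pnatr_eq0; lia.
rewrite sqrf_eq1 natrM => /orP[] /eqP s1.
- have sm : z ^+ n.-1 = eps by rewrite -[LHS]mul1r -eps2 expr2 -mulrA s1 mulr1.
  rewrite zn1 sm epsN /=; apply: CurveRankOne => //.
    apply: (mulfI z0); rewrite -expr2 z1; field.
    by rewrite z0 -mulr2n mulrn_eq0 eps0.
  by field; rewrite z0 eps0.
- have sm : z ^+ n.-1 = - eps.
    by rewrite -[LHS]mul1r -eps2 expr2 -mulrA s1 mulrN1.
  rewrite zn1 sm eqxx /=; apply: CurveDouble => //.
    have -> : z ^+ n = - eps * z by rewrite -sm -exprSr prednK //; lia.
    have -> : z * (n.-1%:R * z ^+ n.-2) = - eps * n.-1%:R.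
      by rewrite -sm mulrCA -exprS prednK 1?mulrC //; lia.
    by field; rewrite ?eps0 ?nP0.
  by field; rewrite z0 eps0.
Qed.

(** For z^2 <> 1 the equation for lam says lam sin mu = eps sin (n mu); compare
the squared moduli. For z^2 = 1 both sides hold. *)
Lemma borderline_curve n eps rho lam u v :
  (2 <= n)%N -> eps ^+ 2 = 1 -> 0 <= v ->
  curve_point n eps rho lam (cis (u +i* v)) ->
  borderline n lam <-> v_root n u v.
Proof.
move=> n2 eps2 v0 cp; set z := cis _ in cp.
have [z1|z1] := eqVneq (z ^+ 2) 1.
  have lamn : borderline n lam.
    rewrite /borderline; case: cp; rewrite ?z1 ?eqxx // => _ _ _ ->.
      by rewrite normr_nat.
    by rewrite normrN normr_nat.
  have /eqP : `|z| = 1.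
    by apply/eqP; rewrite -(@pexpr_eq1 _ _ 2) // -normrX z1 normr1.
  rewrite norm_cis => /eqP [] /eqP.
  rewrite -expR0 (inj_eq (@expR_inj R)) oppr_eq0 => /eqP ve.
  split=> // _; split=> //; rewrite ve mulr0 sinh0 expr0n mulr0 subr0.
  move: z1; rewrite /z ve cisE oppr0 expR0 !mul1r => /eqP.
  rewrite expr2 eq_complex /= => /andP[/eqP h _].
  have su : sin u = 0.
    apply/eqP; rewrite -sqrf_eq0; apply/eqP; have := cos2Dsin2 u; lra.
  have := sin_natmul_le n u; rewrite su normr0 mulr0 normr_le0 => /eqP snu.
  by rewrite /g_ su snu expr0n mulr0 subr0.
case: cp => [_ _ _ lamE|h|h]; [|by rewrite h eqxx in z1..].
have W0 : z != 0 by exact: cis_neq0.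
have lcs : lam * csin (u +i* v) = eps * csin (n%:R * (u +i* v)).
  rewrite csin_natmul -/z -[u +i* v in LHS]mul1r (csin_natmul 1) -/z.
  apply: (mulfI (mulf_neq0 (expf_neq0 n W0) two_i_neq0)).
  transitivity (lam * (z ^+ n.-1 * (z ^+ 2 - 1))); last first.
    by rewrite lamE; field; rewrite neq0Ci expf_neq0.
  have -> : z ^+ n = z * z ^+ n.-1 by rewrite -exprS prednK //; lia.
  by rewrite expr1; field; rewrite neq0Ci.
have nuv : n%:R * (u +i* v) = (n%:R * u) +i* (n%:R * v).
  have -> : n%:R = (n%:R : R)%:C by rewrite rmorph_nat.
  by apply/eqP; rewrite eq_complex /= !mul0r subr0 addr0 !eqxx.
have eps1 : `|eps| ^+ 2 = 1 by rewrite -normrX eps2 normr1.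
have := congr1 (fun x => `|x| ^+ 2) lcs.
rewrite (normrM lam) (normrM eps) (exprMn _ `|lam|) (exprMn _ `|eps|) eps1.
rewrite mul1r nuv !norm_csin.
have s0 : (sin u ^+ 2 + sinh v ^+ 2)%:C != 0 :> R[i].
  rewrite -norm_csin sqrf_eq0 normr_eq0 csinE -/z mulf_neq0 ?invr_eq0 //.
  apply: contra z1; rewrite subr_eq0 => /eqP zV.
  by apply/eqP; rewrite expr2 {2}zV mulfV.
have nC : n%:R ^+ 2 = (n%:R ^+ 2 : R)%:C by rewrite rmorphXn rmorph_nat.
move=> E; split.
  move=> bl; split=> //; move: E; rewrite bl nC -rmorphM => /complexI E.
  by apply: (lincomb1 (-1) E); rewrite /g_; ring.
case=> _ vr; apply/eqP; rewrite -(@eqrXn2 _ 2) ?normr_ge0 ?ler0n //.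
apply/eqP/(mulIf s0); rewrite E nC -rmorphM; congr (_%:C).
by apply: (lincomb1 1 vr); rewrite /g_; ring.
Qed.

Lemma parity_borderline n eps rho lam : (2 <= n)%N -> eps ^+ 2 = 1 ->
  parity_eigenvalue n eps rho lam /\ borderline n lam <->
  exists u, - pi <= u <= pi /\ rho = boundary_ratio eps n (mu_ n u) /\
    lam = eps * b2 n u.
Proof.
move=> n2 eps2; split=> [[ev bl]|[u [upi [-> ->]]]].
  have [z [z0 z1 cp]] := (parity_eigenvalue_curve rho n2 eps2 bl).1 ev.
  have [u [v [upi zE]]] := cis_surj z0.
  have v0 : 0 <= v.
    move: z1; rewrite -zE norm_cis -[1]/(1%:C) lecR -expR0 ler_expR; lra.
  rewrite -zE in cp.
  have vE := v_rootE n2 ((borderline_curve n2 eps2 v0 cp).1 bl).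
  exists u; split=> //; rewrite -vE -/(mu_ n u) in cp.
  exact: curve_point_inj (cis_neq0 _) cp (boundary_ratio_curve u n2 eps2).
have cp := boundary_ratio_curve u n2 eps2; have vr := v_rootP u n2.
have bl : borderline n (eps * b2 n u).
  by apply/(borderline_curve n2 eps2 vr.1 cp).
split=> //; apply/(parity_eigenvalue_curve _ n2 eps2 bl).
exists (cis (mu_ n u)); split=> //; first exact: cis_neq0.
by rewrite norm_cis -[1]/(1%:C) lecR -expR0 ler_expR oppr_le0; case: vr.
Qed.

End Curves.

Theorem theorem4p1 (R : realType) (n : nat) (hn : (2 <= n)%N) :
  (forall u : R, - pi <= u <= pi -> exists! v : R, v_root n u v) /\
  (forall rho lam : R[i],
    (type1_eigenvalue n rho lam /\ borderline n lam <->
      exists u : R, - pi <= u <= pi /\ rho = f1 n u /\ lam = b1 n u) /\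
    (type2_eigenvalue n rho lam /\ borderline n lam <->
      exists u : R, - pi <= u <= pi /\ rho = f2 n u /\ lam = b2 n u)).
Proof.
split=> [u _|rho lam]; first exact: v_root_exists_unique.
split.
  rewrite type1_parity parity_borderline ?sqrrN ?expr1n //.
  by split=> -[u [upi [-> ->]]]; exists u; rewrite f1E // b1E mulN1r.
rewrite type2_parity parity_borderline ?expr1n //.
by split=> -[u [upi [-> ->]]]; exists u; rewrite f2E // mul1r.
Qed.
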